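(* Let $M$ be a finitely presented finite-$\mathcal{J}$-above monoid. Let $A$ be a finite alphabet, let $\varphi:A^*\to M$ be a homomorphism, and let $L\subseteq A^*$ be a language such that for any rational language $R$ in $A^*$ (given by a finite automaton) it is decidable whether $L\cap R$ is empty or not. Then the membership problem for $\varphi(L)$ is decidable in $M$.
   Context: For a monoid $M$ and $u,v\in M$, $u$ is a factor of $v$ if $v=xuy$ for some $x,y\in M$. $M$ is finite-$\mathcal{J}$-above if every element of $M$ has only finitely many factors. ''Finitely presented'' means having a finite presentation as a monoid. A language over a finite alphabet $A$ is a subset of the free monoid $A^*$; it is rational if it is recognized by a finite $A$-automaton. The membership problem for a subset $S\subseteq M$ asks for an algorithm that, given an element $g\in M$ (as a word in the generators), decides whether $g\in S$. *)

(* Defs.v *)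
From HB Require Import structures.
From mathcomp Require Import all_boot.
From mathcomp Require Import boolp classical_sets cardinality.

Set Implicit Arguments.
Unset Strict Implicit.
Unset Printing Implicit Defensive.


Local Open Scope classical_set_scope.
Local Open Scope group_scope.

(* [seq T] is the free monoid on T. *)
HB.instance Definition _ (T : choiceType) :=
  isMonoid.Build (seq T) (@catA T) (@cat0s T) (@cats0 T).

Notation monoid_hom := UMagmaMorphism.type.

Definition generating (M : monoidType) (X : finType)
    (f : monoid_hom (seq X) M) : Prop :=
  forall m : M, exists w : seq X, f w = m.

Section Presentations.
Variables (X : finType) (rels : seq (seq X * seq X)).

(* The least monoid congruence on X^* containing [rels]. *)
Inductive pres_cong : seq X -> seq X -> Prop :=
| pres_cong_rel u v : (u, v) \in rels -> pres_cong u v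
| pres_cong_refl u : pres_cong u u
| pres_cong_sym u v : pres_cong u v -> pres_cong v u
| pres_cong_trans u v w : pres_cong u v -> pres_cong v w -> pres_cong u w
| pres_cong_mul u u' v v' :
    pres_cong u u' -> pres_cong v v' -> pres_cong (u ++ v) (u' ++ v').

End Presentations.

Definition finitely_presented (M : monoidType) : Prop :=
  exists (X : finType) (rels : seq (seq X * seq X))
         (f : monoid_hom (seq X) M),
    generating f /\ forall u v, f u = f v <-> pres_cong rels u v.

Definition factor (M : monoidType) (u v : M) : Prop :=
  exists x y : M, v = x * u * y.

Definition finite_J_above (M : monoidType) : Prop :=
  forall v : M, finite_set [set u | factor u v].

(* The states of a (nondeterministic) finite A-automaton are numbered; only the
   finitely many numbers occurring in the three lists matter. *)
Record automaton (A : finType) := Automaton {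
  initial : seq nat;
  transitions : seq (nat * A * nat);
  terminal : seq nat
}.

Section Automata.
Variable A : finType.
Implicit Type aut : automaton A.

Definition automaton_data aut := (initial aut, transitions aut, terminal aut).
Definition automaton_of_data (d : seq nat * seq (nat * A * nat) * seq nat) :=
  Automaton d.1.1 d.1.2 d.2.
Lemma automaton_dataK : cancel automaton_data automaton_of_data.
Proof. by case. Qed.

HB.instance Definition _ :=
  Countable.copy (automaton A) (can_type automaton_dataK).

Fixpoint run aut (p : nat) (w : seq A) (q : nat) : Prop :=
  if w is a :: w' then
    exists2 r, (p, a, r) \in transitions aut & run aut r w' q
  else p = q.

Definition recognized aut : set (seq A) :=
  [set w | exists p q, [/\ p \in initial aut, q \in terminal aut
                         & run aut p w q]].

End Automata.

(* The total recursive functions: minimization is only applied to f such that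
   every v has an m with f (m, v) = 0. *)
Inductive recursive : forall n, (n.-tuple nat -> nat) -> Prop :=
| rec_zero n : @recursive n (fun=> 0%N)
| rec_succ : @recursive 1 (fun v => (thead v).+1)
| rec_proj n (i : 'I_n) : recursive (fun v => tnth v i)
| rec_comp m n (f : m.-tuple nat -> nat) (g : 'I_m -> n.-tuple nat -> nat) :
    recursive f -> (forall i, recursive (g i)) ->
    recursive (fun v => f [tuple g i v | i < m])
| rec_prim n (f : n.-tuple nat -> nat) (g : n.+2.-tuple nat -> nat)
    (h : n.+1.-tuple nat -> nat) :
    recursive f -> recursive g ->
    (forall v : n.-tuple nat, h [tuple of 0%N :: v] = f v) ->
    (forall m (v : n.-tuple nat), h [tuple of m.+1 :: v] =
       g [tuple of m :: h [tuple of m :: v] :: v]) ->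
    recursive h
| rec_min n (f : n.+1.-tuple nat -> nat) (h : n.-tuple nat -> nat) :
    recursive f ->
    (forall v : n.-tuple nat, f [tuple of h v :: v] = 0%N) ->
    (forall (v : n.-tuple nat) m, (m < h v)%N ->
       f [tuple of m :: v] <> 0%N) ->
    recursive h.

(* Inputs are coded by [pickle].  This is only meaningful for data types whose
   [pickle] is effective, such as words and automata, where it is given by the
   two lemmas below from an arbitrary numbering of the finite alphabet. *)
Definition decidable_problem (T : countType) (P : T -> Prop) : Prop :=
  exists2 f : 1.-tuple nat -> nat,
    recursive f & forall x : T, f [tuple pickle x] = `[< P x >].

Lemma pickle_word (A : finType) (w : seq A) :
  pickle w = CodeSeq.code [seq pickle a | a <- w].
Proof. by []. Qed.

Lemma pickle_automaton (A : finType) (aut : automaton A) :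
  let pair x y := CodeSeq.code [:: x; y] in
  pickle aut =
  pair (pair (CodeSeq.code (initial aut))
             (CodeSeq.code [seq pair (pair t.1.1 (pickle t.1.2)) t.2
                           | t <- transitions aut]))
       (CodeSeq.code (terminal aut)).
Proof.
case: aut => i t f /=.
have pickle_nats (s : seq nat) : pickle s = CodeSeq.code s.
  by rewrite -[in RHS](map_id s).
by rewrite -(pickle_nats i) -(pickle_nats f).
Qed.

Definition membership_decidable (M : monoidType) (S : set M) : Prop :=
  forall (X : finType) (f : monoid_hom (seq X) M),
    generating f -> decidable_problem (fun w : seq X => S (f w)).

(* Main.v *)
(* The words equal to w in M form a rational language: its automaton has the
   finitely many factors of w as states. Such an automaton can be certified
   without knowing M, only from the presentation: label the states by words,
   give derivations of xa = y for each transition from x to y by the letter a,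
   and check that for each relation (u, v) the paths labelled u and v lead from
   any given state to the same states. By finite presentability a certificate
   can be found by exhaustive search. Replacing the letters of A by words for
   their images then yields an automaton for phi^-1(w), and the oracle tells
   whether L meets it. *)

Require Import Defs.
From HB Require Import structures.
From mathcomp Require Import all_boot zify.
From mathcomp Require Import boolp classical_sets cardinality.

Set Implicit Arguments.
Unset Strict Implicit.
Unset Printing Implicit Defensive.

Local Open Scope classical_set_scope.
Local Open Scope nat_scope.

(** * Recursive functions of natural numbers *)

Lemma eq_recursive n (f g : n.-tuple nat -> nat) :
  f =1 g -> recursive f -> recursive g.
Proof. by move=> /funext ->. Qed.

Definition rec1 (f : nat -> nat) :=
  recursive (fun v : 1.-tuple nat => f (thead v)).
Definition rec2 (f : nat -> nat -> nat) :=
  recursive (fun v : 2.-tuple nat => f (tnth v ord0) (tnth v ord_max)).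

Lemma recursive_comp1 n f (g : n.-tuple nat -> nat) :
  rec1 f -> recursive g -> recursive (fun v => f (g v)).
Proof.
move=> rf rg; apply: eq_recursive (rec_comp rf (fun=> rg)) => v.
by rewrite /thead tnth_mktuple.
Qed.

Lemma recursive_comp2 n f (g h : n.-tuple nat -> nat) :
  rec2 f -> recursive g -> recursive h -> recursive (fun v => f (g v) (h v)).
Proof.
move=> rf rg rh; pose k (i : 'I_2) := if i == ord0 then g else h.
have rk i : recursive (k i) by rewrite /k; case: ifP.
by apply: eq_recursive (rec_comp rf rk) => v; rewrite !tnth_mktuple.
Qed.

Lemma eq_rec1 f g : f =1 g -> rec1 f -> rec1 g.
Proof. by move=> /funext ->. Qed.

Lemma rec1_id : rec1 id.
Proof. exact: rec_proj. Qed.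

Lemma rec1_comp1 f g : rec1 f -> rec1 g -> rec1 (fun x => f (g x)).
Proof. exact: recursive_comp1. Qed.

Lemma rec1_comp2 f g h :
  rec2 f -> rec1 g -> rec1 h -> rec1 (fun x => f (g x) (h x)).
Proof. exact: recursive_comp2. Qed.

Lemma rec2_fst f : rec1 f -> rec2 (fun x _ => f x).
Proof. by move=> rf; apply: recursive_comp1 => //; apply: rec_proj. Qed.

Lemma rec2_snd f : rec1 f -> rec2 (fun _ => f).
Proof. by move=> rf; apply: recursive_comp1 => //; apply: rec_proj. Qed.

Lemma rec2_comp1 f g : rec1 f -> rec2 g -> rec2 (fun x y => f (g x y)).
Proof. exact: recursive_comp1. Qed.

Lemma rec2_comp2 f g h :
  rec2 f -> rec2 g -> rec2 h -> rec2 (fun x y => f (g x y) (h x y)).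
Proof. exact: recursive_comp2. Qed.

Lemma rec1_succ : rec1 succn.
Proof. exact: rec_succ. Qed.

Lemma rec1_const n : rec1 (fun=> n).
Proof.
by elim: n => [|n IH]; [apply: rec_zero | apply: rec1_comp1 rec1_succ IH].
Qed.

(** This is [rec_prim] with a single parameter [x]; the step receives the counter, the previous
    value and [x], in this order. *)
Lemma rec2_nat_rect (a : nat -> nat) (s : nat -> nat -> nat -> nat) :
  rec1 a ->
  recursive (fun v : 3.-tuple nat =>
    s (tnth v ord0) (tnth v (lift ord0 ord0)) (tnth v ord_max)) ->
  rec2 (fun m x => nat_rect (fun=> nat) (a x) (fun k y => s k y x) m).
Proof.
move=> ra rs; apply: rec_prim ra rs _ _ => [v|m v] /=.
  by case/tupleP: v => x v; rewrite tuple0.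
by case/tupleP: v => x v; rewrite tuple0.
Qed.

Lemma rec2_iter (a : nat -> nat) (s : nat -> nat -> nat) :
  rec1 a -> rec2 s -> rec2 (fun m x => iter m (s x) (a x)).
Proof.
move=> ra rs.
have := rec2_nat_rect (s := fun _ y x => s x y) ra _.
by apply; apply: recursive_comp2 => //; apply: rec_proj.
Qed.

(** The recursion returns its own counter and forgets the previous value. *)
Lemma rec1_pred : rec1 predn.
Proof.
have: rec2 (fun m x => nat_rect (fun=> nat) 0 (fun k _ => k) m).
  by apply: rec2_nat_rect; [apply: rec1_const | apply: rec_proj].
move=> /rec1_comp2 /(_ rec1_id rec1_id); apply: eq_rec1; by case.
Qed.

Lemma rec2_add : rec2 addn.
Proof.
have := rec2_iter rec1_id (rec2_snd rec1_succ).
by congr rec2; apply/funext => m; apply/funext => x; rewrite iter_succn addnC.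
Qed.

Lemma rec2_mul : rec2 muln.
Proof.
have := rec2_iter (rec1_const 0) rec2_add.
by congr rec2; apply/funext => m; apply/funext => x; rewrite iter_addn_0 mulnC.
Qed.

Lemma rec2_sub : rec2 subn.
Proof.
have rs := rec2_iter rec1_id (rec2_snd rec1_pred).
have := rec2_comp2 rs (rec2_snd rec1_id) (rec2_fst rec1_id).
by congr rec2; apply/funext => x; apply/funext => m; rewrite iter_predn.
Qed.

Lemma rec1_double : rec1 double.
Proof.
by apply: (eq_rec1 _ (rec1_comp2 rec2_add rec1_id rec1_id)) => x; rewrite addnn.
Qed.

Lemma rec1_expn2 : rec1 (expn 2).
Proof.
have := rec2_iter (rec1_const 1) (rec2_snd rec1_double).
move=> /rec1_comp2 /(_ rec1_id rec1_id); apply: eq_rec1 => m.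
by elim: m => // m /= ->; rewrite expnS mul2n.
Qed.

Lemma rec1_mu f (h : nat -> nat) :
  rec2 f -> (forall x, f (h x) x = 0) ->
  (forall x m, m < h x -> f m x <> 0) -> rec1 h.
Proof.
move=> rf f0 fN; apply: (rec_min rf) => [v|v m lt_m] /=.
  by case/tupleP: v => x v; rewrite tuple0; apply: f0.
by case/tupleP: v lt_m => x v lt_m; rewrite tuple0; apply: fN.
Qed.

(** The half of [x] is the least [m] with [x <= 2m + 1], a condition expressed by the vanishing of a
    truncated difference. *)
Lemma rec1_half : rec1 half.
Proof.
apply: (@rec1_mu (fun m x => x - m.*2.+1)) => [|x|x m]; last by lia.
  apply: rec2_comp2 (rec2_snd rec1_id) _; first exact: rec2_sub.
  exact: rec2_fst (rec1_comp1 rec1_succ rec1_double).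
by lia.
Qed.

(** * Effectivity of the coding of sequences *)

(** [CodeSeq.code] sends the empty sequence to 0 and [n :: s] to [2 ^ n] times the odd number
    [2 * code s + 1]. On a nonzero code the head is thus the 2-adic valuation, and the tail is the
    half of the odd part. *)
Definition code_head c := head 0 (CodeSeq.decode c).
Definition code_tail c := CodeSeq.code (behead (CodeSeq.decode c)).
Definition code_cons n c := 2 ^ n * c.*2.+1.

Lemma iter_half_expn2 m n : iter m half (2 ^ m * n) = n.
Proof.
elim: m => [|m IH]; first by rewrite mul1n.
by rewrite iterSr expnS -mulnA mul2n doubleK.
Qed.

Lemma rec2_cons : rec2 code_cons.
Proof.
apply: rec2_comp2 rec2_mul (rec2_fst rec1_expn2) _.
exact: rec2_snd (rec1_comp1 rec1_succ rec1_double).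
Qed.

Lemma rec2_iter_half : rec2 (fun m x => iter m half x).
Proof. exact: rec2_iter rec1_id (rec2_snd rec1_half). Qed.

(** Minimization finds the 2-adic valuation, as the least number of halvings that leads to an odd
    number. *)
Lemma rec1_head : rec1 code_head.
Proof.
pose bit y := y - y./2.*2.
have rbit : rec1 bit.
  apply: rec1_comp2 rec2_sub rec1_id _.
  exact: rec1_comp1 rec1_double rec1_half.
(* The factor [x] stops the search at once on the code 0 of the empty sequence, whose halvings are
   never odd. *)
apply: (@rec1_mu (fun m x => x * (1 - bit (iter m half x)))) => [|x|x m].
- apply: rec2_comp2 rec2_mul (rec2_snd rec1_id) _.
  apply: rec2_comp2 rec2_sub (rec2_fst (rec1_const 1)) _.
  exact: rec2_comp1 rbit rec2_iter_half.
- rewrite -(CodeSeq.decodeK x) /code_head CodeSeq.codeK.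
  by case: (CodeSeq.decode x) => //= n s; rewrite (iter_half_expn2 n) /bit; lia.
rewrite -(CodeSeq.decodeK x) /code_head CodeSeq.codeK.
case: (CodeSeq.decode x) => //= n s lt_mn.
(* Before the valuation is reached, halving leaves a positive even number, so neither factor
   vanishes. *)
have [d d_gt0 ->] : exists2 d, 0 < d &
    2 ^ n * (CodeSeq.code s).*2.+1 = 2 ^ m * d.*2.
  exists (2 ^ (n - m.+1) * (CodeSeq.code s).*2.+1).
    by rewrite muln_gt0 expn_gt0.
  by rewrite -{1}(subnKC lt_mn) addSnnS expnD expnS -!mul2n !mulnA.
rewrite (iter_half_expn2 m) /bit doubleK subnn muln1.
by apply/eqP; rewrite muln_eq0 double_eq0 expn_eq0 /= -lt0n.
Qed.

(** Halving as often as the head says leaves the odd part, and one more halving leaves the code of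
    the tail; the code 0 is sent to 0. *)
Lemma rec1_tail : rec1 code_tail.
Proof.
have := rec1_comp1 rec1_half (rec1_comp2 rec2_iter_half rec1_head rec1_id).
apply: eq_rec1 => x; rewrite -(CodeSeq.decodeK x) /code_tail /code_head.
rewrite CodeSeq.codeK; case: (CodeSeq.decode x) => //= n s.
by rewrite (iter_half_expn2 n); lia.
Qed.

Lemma code_consE n c : code_cons n c = CodeSeq.code (n :: CodeSeq.decode c).
Proof. by rewrite /= CodeSeq.decodeK. Qed.

Lemma code_head_cons n c : code_head (code_cons n c) = n.
Proof. by rewrite code_consE /code_head CodeSeq.codeK. Qed.

Lemma code_tail_cons n c : code_tail (code_cons n c) = c.
Proof. by rewrite code_consE /code_tail CodeSeq.codeK /= CodeSeq.decodeK. Qed.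

Lemma code_cons_gt n c : c < code_cons n c.
Proof. by rewrite /code_cons; have := expn_gt0 2 n; nia. Qed.

Lemma size_le_code s : size s <= CodeSeq.code s.
Proof.
by elim: s => //= n s IH; apply: leq_ltn_trans IH (code_cons_gt n _).
Qed.

(** This is the code of the sequence of length two, which is how [pickle] codes pairs. *)
Definition code_pair x y := code_cons x (code_cons y 0).
Definition code_fst c := code_head c.
Definition code_snd c := code_head (code_tail c).

Lemma code_pairK1 x y : code_fst (code_pair x y) = x.
Proof. exact: code_head_cons. Qed.

Lemma code_pairK2 x y : code_snd (code_pair x y) = y.
Proof. by rewrite /code_snd code_tail_cons code_head_cons. Qed.

Lemma rec2_pair : rec2 code_pair.
Proof.
apply: rec2_comp2 rec2_cons (rec2_fst rec1_id) _.
exact: rec2_comp2 rec2_cons (rec2_snd rec1_id) (rec2_fst (rec1_const 0)).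
Qed.

Lemma rec1_snd : rec1 code_snd.
Proof. exact: rec1_comp1 rec1_head rec1_tail. Qed.

(** The truncated differences [1 - f] and [1 - (1 - f)] are the indicators of the two branches. *)
Lemma rec2_if f g h : rec2 f -> rec2 g -> rec2 h ->
  rec2 (fun x y => if f x y == 0 then g x y else h x y).
Proof.
move=> rf rg rh.
have r1 : rec2 (fun x y => 1 - f x y).
  by apply: rec2_comp2 rec2_sub (rec2_fst (rec1_const 1)) rf.
have r2 : rec2 (fun x y => 1 - (1 - f x y)).
  by apply: rec2_comp2 rec2_sub (rec2_fst (rec1_const 1)) r1.
have := rec2_comp2 rec2_add (rec2_comp2 rec2_mul r1 rg)
  (rec2_comp2 rec2_mul r2 rh).
congr rec2; apply/funext => x; apply/funext => y; case: eqP => [->|nz].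
  by rewrite mul1n addn0.
have -> : 1 - f x y = 0 by lia.
by rewrite mul1n.
Qed.

(** * Computable functions between countable types *)

(** The total function [g] is constrained only on codes of elements of [T]; its other values are
    arbitrary. *)
Definition computable (T U : countType) (f : T -> U) :=
  exists2 g : nat -> nat, rec1 g & forall x, g (pickle x) = pickle (f x).

Lemma eq_computable (T U : countType) (f g : T -> U) :
  f =1 g -> computable f -> computable g.
Proof. by move=> /funext ->. Qed.

Lemma decidable_computable (T : countType) (P : T -> Prop) :
  decidable_problem P <-> computable (fun x => `[< P x >]).
Proof.
split=> [[f rf fP]|[g rg gP]].
  exists (fun n => f [tuple n]) => [|x]; last by rewrite fP; case: asboolP.
  apply: eq_recursive rf => v; congr f; apply: val_inj.
  by case/tupleP: v => x v; rewrite tuple0.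
by exists (fun v => g (thead v)) => // x; rewrite [LHS]gP; case: asboolP.
Qed.

Lemma computable_id (T : countType) : computable (@id T).
Proof. by exists id => //; apply: rec1_id. Qed.

Lemma computable_comp (T U V : countType) (f : U -> V) (g : T -> U) :
  computable f -> computable g -> computable (fun x => f (g x)).
Proof.
move=> [F rF FE] [G rG GE]; exists (fun x => F (G x)).
  exact: rec1_comp1.
by move=> x; rewrite GE FE.
Qed.

Lemma computable_const (T U : countType) (y : U) : computable (fun _ : T => y).
Proof. by exists (fun=> pickle y) => //; apply: rec1_const. Qed.

(** On [nat] the function [pickle] is the identity, so the same recursive function serves. *)
Lemma computable_pickle (T U : countType) (f : T -> U) :
  computable f -> computable (fun x => pickle (f x)).
Proof. by []. Qed.

Lemma computable_pair (T U V : countType) (f : T -> U) (g : T -> V) :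
  computable f -> computable g -> computable (fun x => (f x, g x)).
Proof.
move=> [F rF FE] [G rG GE]; exists (fun x => code_pair (F x) (G x)).
  exact: rec1_comp2 rec2_pair rF rG.
by move=> x; rewrite FE GE.
Qed.

Lemma computable_fst (T U V : countType) (f : T -> U * V) :
  computable f -> computable (fun x => (f x).1).
Proof.
apply: computable_comp; exists code_fst; first exact: rec1_head.
by case=> x y; apply: code_pairK1.
Qed.

Lemma computable_snd (T U V : countType) (f : T -> U * V) :
  computable f -> computable (fun x => (f x).2).
Proof.
apply: computable_comp; exists code_snd; first exact: rec1_snd.
by case=> x y; apply: code_pairK2.
Qed.

Lemma computable_comp2 (T U V W : countType) (h : U -> V -> W)
    (f : T -> U) (g : T -> V) :
  computable (fun p : U * V => h p.1 p.2) -> computable f -> computable g ->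
  computable (fun x => h (f x) (g x)).
Proof.
by move=> ch cf cg; apply: computable_comp ch (computable_pair cf cg).
Qed.

Lemma computable_if (T U : countType) (b : T -> bool) (f g : T -> U) :
  computable b -> computable f -> computable g ->
  computable (fun x => if b x then f x else g x).
Proof.
move=> [B rB BE] [F rF FE] [G rG GE].
exists (fun x => if B x == 0 then G x else F x).
  by have := rec1_comp2 (rec2_if (rec2_fst rB) (rec2_fst rG) (rec2_fst rF))
    rec1_id rec1_id.
by move=> x; rewrite BE FE GE; case: (b x).
Qed.

(** As [pickle] is injective, equality can be tested on codes, where it means that both truncated
    differences vanish. *)
Lemma computable_eq (T U : countType) (f g : T -> U) :
  computable f -> computable g -> computable (fun x => f x == g x).
Proof.
move=> [F rF FE] [G rG GE].
exists (fun x => if (F x - G x) + (G x - F x) == 0 then 1 else 0).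
  have r1 : rec2 (fun x y => (x - y) + (y - x)).
    apply: rec2_comp2 rec2_add rec2_sub _.
    exact: rec2_comp2 rec2_sub (rec2_snd rec1_id) (rec2_fst rec1_id).
  have r2 := rec2_if r1 (rec2_fst (rec1_const 1)) (rec2_fst (rec1_const 0)).
  exact: rec1_comp2 r2 rF rG.
move=> x; rewrite FE GE addn_eq0 !subn_eq0 -eqn_leq.
by rewrite (inj_eq (pcan_inj pickleK)); case: eqP.
Qed.

Lemma computable_and (T : countType) (a b : T -> bool) :
  computable a -> computable b -> computable (fun x => a x && b x).
Proof.
by move=> ca cb; apply: computable_if ca cb (computable_const _ false).
Qed.

Lemma computable_or (T : countType) (a b : T -> bool) :
  computable a -> computable b -> computable (fun x => a x || b x).
Proof.
by move=> ca cb; apply: computable_if ca (computable_const _ true) cb.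
Qed.

Lemma computable_not (T : countType) (a : T -> bool) :
  computable a -> computable (fun x => ~~ a x).
Proof.
by move=> ca; apply: computable_if ca (computable_const _ false)
  (computable_const _ true).
Qed.

(** * Iteration, recursion on sequences and search *)

Lemma computable_iter (G U : countType) (m : G -> nat) (f : G -> U -> U)
    (a : G -> U) :
  computable m -> computable (fun p : G * U => f p.1 p.2) -> computable a ->
  computable (fun x => iter (m x) (f x) (a x)).
Proof.
move=> [N rN NE] [F rF FE] [A rA AE].
exists (fun x => iter (N x) (fun y => F (code_pair x y)) (A x)).
  have rs := rec2_iter rA (rec2_comp1 rF rec2_pair).
  exact: rec1_comp2 rs rN rec1_id.
move=> x; rewrite NE AE; elim: (m x) => //= n ->; exact: (FE (x, _)).
Qed.

(* The loop keeps the pair of the accumulator and the remaining sequence; since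
   a sequence is shorter than its code, the code is a sufficient number of
   rounds. *)
Lemma computable_foldl (G T U : countType) (f : G -> U -> T -> U)
    (a : G -> U) (s : G -> seq T) :
  computable (fun p : G * U * T => f p.1.1 p.1.2 p.2) ->
  computable a -> computable s ->
  computable (fun x => foldl (f x) (a x) (s x)).
Proof.
move=> [F rF FE] [A rA AE] [S rS SE].
pose step x y := if code_snd y == 0 then y else
  code_pair (F (code_pair (code_pair x (code_fst y)) (code_head (code_snd y))))
            (code_tail (code_snd y)).
have r2 h : rec1 h -> rec2 (fun _ y => h y) by apply: rec2_snd.
have rsnd := rec2_snd rec1_snd.
have rstep : rec2 step.
  apply: rec2_if => //; first exact: r2 rec1_id.
  apply: rec2_comp2 rec2_pair _ (rec2_comp1 rec1_tail rsnd).
  apply: (rec2_comp1 rF).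
  apply: rec2_comp2 rec2_pair _ (rec2_comp1 rec1_head rsnd).
  exact: rec2_comp2 rec2_pair (rec2_fst rec1_id) (r2 _ rec1_head).
exists (fun x => code_fst (iter (S x) (step x) (code_pair (A x) (S x)))).
  apply: rec1_comp1 rec1_head _.
  apply: rec1_comp2 (rec2_iter (rec1_comp2 rec2_pair rA rS) rstep) rS rec1_id.
move=> x; rewrite SE AE.
(* A pair whose remaining sequence is empty is fixed by [step], so surplus rounds are harmless. *)
have stepP : forall (r : seq T) u n, size r <= n ->
    iter n (step (pickle x)) (code_pair (pickle u) (pickle r)) =
    code_pair (pickle (foldl (f x) u r)) 0.
  elim=> [|y r IH] u n.
    by move=> _; elim: n => // n IH; rewrite iterS IH /step code_pairK2 eqxx.
  case: n => // n lt_rn; rewrite iterSr /step code_pairK2 code_pairK1.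
  have -> : pickle (y :: r) = code_cons (pickle y) (pickle r) by [].
  rewrite gtn_eqF; last by apply: leq_ltn_trans (code_cons_gt _ _).
  by rewrite code_head_cons code_tail_cons (FE (x, u, y)) IH.
rewrite stepP ?code_pairK1 //.
by apply: leq_trans (size_le_code _); rewrite size_map.
Qed.

Lemma computable_cons (G T : countType) (y : G -> T) (s : G -> seq T) :
  computable y -> computable s -> computable (fun x => y x :: s x).
Proof.
move=> [Y rY YE] [S rS SE]; exists (fun x => code_cons (Y x) (S x)).
  exact: rec1_comp2 rec2_cons rY rS.
by move=> x; rewrite YE SE.
Qed.

Ltac comp_proj := by do ?[exact: computable_id | exact: computable_const
  | apply: computable_fst | apply: computable_snd].

Lemma computable_rev (G T : countType) (s : G -> seq T) :
  computable s -> computable (fun x => rev (s x)).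
Proof.
move=> cs; have : computable (fun x => foldl (fun r y => y :: r) [::] (s x)).
  by apply: computable_foldl => //; [apply: computable_cons | ]; comp_proj.
apply: eq_computable => x; rewrite -[s x in LHS]revK foldl_rev.
by elim: (rev _) => //= y r ->.
Qed.

Lemma computable_foldr (G T U : countType) (f : G -> T -> U -> U)
    (a : G -> U) (s : G -> seq T) :
  computable (fun p : G * T * U => f p.1.1 p.1.2 p.2) ->
  computable a -> computable s ->
  computable (fun x => foldr (f x) (a x) (s x)).
Proof.
move=> cf ca cs.
have : computable (fun x => foldl (fun z y => f x y z) (a x) (rev (s x))).
  apply: computable_foldl ca (computable_rev cs).
  apply: (computable_comp (g := fun p => (p.1.1, p.2, p.1.2)) cf).
  by apply: computable_pair; [apply: computable_pair | ]; comp_proj.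
by apply: eq_computable => x; rewrite foldl_rev.
Qed.

Lemma computable_cat (G T : countType) (r s : G -> seq T) :
  computable r -> computable s -> computable (fun x => r x ++ s x).
Proof.
move=> cr cs.
have : computable (fun x => foldr (fun y z => y :: z) (s x) (r x)).
  by apply: computable_foldr => //; apply: computable_cons; comp_proj.
by apply: eq_computable => x; elim: (r x) => //= y t ->.
Qed.


Lemma computable_map (G T U : countType) (f : G -> T -> U) (s : G -> seq T) :
  computable (fun p : G * T => f p.1 p.2) -> computable s ->
  computable (fun x => [seq f x y | y <- s x]).
Proof.
move=> cf cs.
have : computable (fun x => foldr (fun y z => f x y :: z) [::] (s x)).
  apply: computable_foldr => //; last by comp_proj.
  by apply: computable_cons; [apply: (computable_comp2 cf) | ]; comp_proj.
exact.
Qed.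

Lemma computable_flatten (G T : countType) (s : G -> seq (seq T)) :
  computable s -> computable (fun x => flatten (s x)).
Proof.
move=> cs; apply: computable_foldr cs => //; last by comp_proj.
by apply: computable_cat; comp_proj.
Qed.

Lemma computable_filter (G T : countType) (a : G -> T -> bool)
    (s : G -> seq T) :
  computable (fun p : G * T => a p.1 p.2) -> computable s ->
  computable (fun x => [seq y <- s x | a x y]).
Proof.
move=> ca cs; have : computable (fun x =>
    foldr (fun y z => if a x y then y :: z else z) [::] (s x)).
  apply: computable_foldr => //; last by comp_proj.
  apply: computable_if; first by apply: (computable_comp2 ca); comp_proj.
    by apply: computable_cons; comp_proj.
  by comp_proj.
exact.
Qed.

Lemma computable_has (G T : countType) (a : G -> T -> bool) (s : G -> seq T) :
  computable (fun p : G * T => a p.1 p.2) -> computable s ->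
  computable (fun x => has (a x) (s x)).
Proof.
move=> ca cs.
have : computable (fun x => foldr (fun y z => a x y || z) false (s x)).
  apply: computable_foldr => //; last by comp_proj.
  by apply: computable_or; [apply: (computable_comp2 ca) | ]; comp_proj.
exact.
Qed.

Lemma computable_all (G T : countType) (a : G -> T -> bool) (s : G -> seq T) :
  computable (fun p : G * T => a p.1 p.2) -> computable s ->
  computable (fun x => all (a x) (s x)).
Proof.
move=> ca cs.
have : computable (fun x => foldr (fun y z => a x y && z) true (s x)).
  apply: computable_foldr => //; last by comp_proj.
  by apply: computable_and; [apply: (computable_comp2 ca) | ]; comp_proj.
exact.
Qed.

Lemma computable_mem (G T : countType) (y : G -> T) (s : G -> seq T) :
  computable y -> computable s -> computable (fun x => y x \in s x).
Proof.
move=> cy cs; have : computable (fun x => has (fun z => z == y x) (s x)).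
  apply: computable_has => //; apply: computable_eq; first comp_proj.
  by apply: (computable_comp cy); comp_proj.
by apply: eq_computable => x; rewrite has_pred1.
Qed.

Lemma computable_allpairs (G S T U : countType) (f : G -> S -> T -> U)
    (s : G -> seq S) (t : G -> S -> seq T) :
  computable (fun p : G * S * T => f p.1.1 p.1.2 p.2) ->
  computable s -> computable (fun p : G * S => t p.1 p.2) ->
  computable (fun x => [seq f x y z | y <- s x, z <- t x y]).
Proof.
move=> cf cs ct; apply: computable_flatten; apply: computable_map => //.
exact: computable_map ct.
Qed.

(* A function on a finite type is computed by a finite table, which is looked up
   by codes. *)
Lemma computable_pickle_inv (G : countType) (T : finType) (U : countType)
    (f : T -> U) (u : U) (n : G -> nat) :
  computable n -> computable (fun x => oapp f u (pickle_inv (n x))).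
Proof.
move=> cn; have : computable (fun x => foldr
    (fun p z => if n x == p.1 then p.2 else z) u
    [seq (pickle y, f y) | y <- enum T]).
  apply: computable_foldr; try comp_proj.
  apply: computable_if; try comp_proj.
  apply: computable_eq; last by comp_proj.
  by apply: (computable_comp cn); comp_proj.
apply: eq_computable => x.
case Dn: (@pickle_inv T (n x)) => [t|] /=; last first.
  elim: (enum T) => //= y r ->; case: eqP => // Ey.
  by rewrite Ey pickleK_inv in Dn.
have := @pickle_invK T (n x); rewrite Dn /= => <-.
have: t \in enum T by rewrite mem_enum.
elim: (enum T) => //= y r IH; rewrite inE (inj_eq (pcan_inj pickleK)).
by case: eqP => [-> //|_ /IH].
Qed.

Lemma computable_finType (G : countType) (T : finType) (U : countType)
    (f : T -> U) (y : G -> T) :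
  computable y -> computable (fun x => f (y x)).
Proof.
move=> cy; case: (pickP T) => [t _|T0].
  have := computable_pickle_inv f (f t) (computable_pickle cy).
  by apply: eq_computable => x; rewrite pickleK_inv.
(* If [T] is empty then so is [G], and there is nothing to compute. *)
by exists id => [|x]; [apply: rec1_id | have := T0 (y x)].
Qed.

(** The least witness is found by minimizing over the zeros of [1 - R]. Only total functions are
    [recursive], so a witness is required for every number [x]. *)
Lemma computable_search (R : nat -> nat -> bool) :
  computable (fun p : nat * nat => R p.1 p.2) -> (forall x, exists n, R x n) ->
  exists2 h : nat -> nat, computable h & forall x, R x (h x).
Proof.
move=> [F rF FE] Rex; pose h x := ex_minn (Rex x).
exists h; last by move=> x; rewrite /h; case: ex_minnP.
exists h => //.
apply: (@rec1_mu (fun m x => 1 - F (code_pair x m))) => [|x|x m].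
- apply: rec2_comp2 rec2_sub (rec2_fst (rec1_const 1)) (rec2_comp1 rF _).
  exact: rec2_comp2 rec2_pair (rec2_snd rec1_id) (rec2_fst rec1_id).
- by rewrite /h; case: ex_minnP => m Rm _; rewrite (FE (x, m)) /= Rm.
rewrite /h; case: ex_minnP => n _ n_min lt_mn; rewrite (FE (x, m)) /=.
by case: (R x m) (n_min m) => // /(_ isT); rewrite leqNgt lt_mn.
Qed.

(** * Effective enumerations *)

(** Repetitions are allowed, as the enumeration only serves exhaustive search. *)
Definition enumerable (T : countType) :=
  exists2 e : nat -> T, computable e & forall x, exists n, e n = x.

Lemma enumerable_nat : enumerable nat.
Proof. by exists id; [apply: computable_id | move=> x; exists x]. Qed.

(** A sequence of numbers is pickled to its own code, so decoding is the identity on codes. *)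
Lemma computable_decode : computable CodeSeq.decode.
Proof.
exists id; first exact: rec1_id.
move=> x; rewrite -[LHS]CodeSeq.decodeK; congr CodeSeq.code.
by rewrite [RHS]map_id.
Qed.

Lemma enumerable_prod (T U : countType) :
  enumerable T -> enumerable U -> enumerable (T * U)%type.
Proof.
move=> [e ce eP] [d cd dP].
exists (fun n => (e (code_fst n), d (code_snd n))) => [|[x y]].
  apply: computable_pair; apply: computable_comp => //.
    by exists code_fst => //; apply: rec1_head.
  by exists code_snd => //; apply: rec1_snd.
have [m <-] := eP x; have [n <-] := dP y.
by exists (code_pair m n); rewrite code_pairK1 code_pairK2.
Qed.

Lemma enumerable_seq (T : countType) : enumerable T -> enumerable (seq T).
Proof.
move=> [e ce eP]; exists (fun n => map e (CodeSeq.decode n)) => [|s].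
  apply: computable_map computable_decode.
  by apply: computable_comp ce _; comp_proj.
have [r <-] : exists r, map e r = s; last first.
  by exists (CodeSeq.code r); rewrite CodeSeq.codeK.
elim: s => [|x s [r <-]]; first by exists [::].
by have [n <-] := eP x; exists (n :: r).
Qed.

(** Numbers that code no letter contribute the empty word. This serves both to enumerate words and
    to read an input word from its code. *)
Lemma computable_word (G : countType) (X : finType) (T : countType)
    (f : X -> seq T) (s : G -> seq nat) :
  computable s ->
  computable (fun x => flatten [seq oapp f [::] (pickle_inv n) | n <- s x]).
Proof.
move=> cs; apply: computable_flatten; apply: computable_map => //.
by apply: computable_pickle_inv; comp_proj.
Qed.

(* Decoding letters to words of length at most one covers the empty alphabet. *)
Lemma enumerable_word (X : finType) : enumerable (seq X).
Proof.
exists (fun n => flatten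
  [seq oapp (fun x : X => [:: x]) [::] (pickle_inv m) | m <- CodeSeq.decode n]).
  exact: computable_word computable_decode.
move=> w; exists (pickle w); rewrite pickle_word CodeSeq.codeK -map_comp.
rewrite (eq_map (g := fun x => [:: x])) => [|x /=]; last by rewrite pickleK_inv.
exact: flatten_seq1.
Qed.

(** * Certified automata for congruence classes *)

Section Certificates.
Variables (X : finType) (rels : seq (seq X * seq X)).
Notation word := (seq X).
Notation cong := (pres_cong rels).

(* The second family of pairs is meant for transitivity; when the two middle
   words differ it yields a harmless reflexive pair. *)
Definition derive (K : seq (word * word)) : seq (word * word) :=
  K ++ [seq (p.2, p.1) | p <- K]
    ++ [seq (p.1, if p.2 == q.1 then q.2 else p.1) | p <- K, q <- K]
    ++ [seq (p.1 ++ q.1, p.2 ++ q.2) | p <- K, q <- K].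

(** Reflexivity is put in only for the empty word and the letters, which keeps every level finite;
    products supply the other reflexive pairs. *)
Definition derived n : seq (word * word) :=
  iter n derive (([::], [::]) :: [seq ([:: x], [:: x]) | x <- enum X] ++ rels).

Lemma derived_sound n p : p \in derived n -> cong p.1 p.2.
Proof.
elim: n p => [|n IH] p /=.
  rewrite inE mem_cat => /predU1P[->|/orP[/mapP[x _ ->]|]].
  - exact: pres_cong_refl.
  - exact: pres_cong_refl.
  - by case: p => u v; apply: pres_cong_rel.
rewrite !mem_cat => /or4P[/IH //|/mapP[q /IH ? ->]||].
- exact: pres_cong_sym.
- move=> /allpairsP[[q r] [/IH /= qc /IH rc ->]] /=.
  case: eqP => [Eqr|_]; last exact: pres_cong_refl.
  by rewrite Eqr in qc; apply: pres_cong_trans qc rc.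
- by move=> /allpairsP[[q r] [/IH /= qc /IH rc ->]]; apply: pres_cong_mul.
Qed.

Lemma derived_mono m n : m <= n -> {subset derived m <= derived n}.
Proof.
move=> /subnKC <-; elim: (n - m) => [|k IH] p; first by rewrite addn0.
by move=> /IH p_k; rewrite addnS /= mem_cat p_k.
Qed.

Lemma derived_refl u : exists n, (u, u) \in derived n.
Proof.
elim: u => [|x u [n un]]; first by exists 0; rewrite inE eqxx.
exists n.+1; rewrite /= !mem_cat; apply/or4P/Or44/allpairsP.
exists (([:: x], [:: x]), (u, u)); split=> //=.
apply: (derived_mono (leq0n n)); rewrite inE mem_cat.
by apply/or3P/Or32/map_f; rewrite mem_enum.
Qed.

(** By induction on the congruence: levels increase, so two premises can be moved to a common level,
    and one more round applies the rule. *)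
Lemma derived_complete u v : cong u v -> exists n, (u, v) \in derived n.
Proof.
elim=> {u v} [u v uv|u|u v _ [n un]|u v w _ [m uv] _ [n vw]
             |u u' v v' _ [m uv] _ [n vw]].
- by exists 0; rewrite inE mem_cat uv !orbT.
- exact: derived_refl.
- by exists n.+1; rewrite /= !mem_cat; apply/or4P/Or42/mapP; exists (u, v).
- exists (maxn m n).+1; rewrite /= !mem_cat; apply/or4P/Or43/allpairsP.
  exists ((u, v), (v, w)); rewrite /= eqxx; split=> //.
    exact: derived_mono (leq_maxl _ _) _ uv.
  exact: derived_mono (leq_maxr _ _) _ vw.
exists (maxn m n).+1; rewrite /= !mem_cat; apply/or4P/Or44/allpairsP.
exists ((u, u'), (v, v')); split=> //=.
  exact: derived_mono (leq_maxl _ _) _ uv.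
exact: derived_mono (leq_maxr _ _) _ vw.
Qed.

(** Thanks to this, a certificate can name one level for all of its derivations. *)
Lemma derived_all (s : seq (word * word)) :
  {in s, forall p, cong p.1 p.2} -> exists n, {subset s <= derived n}.
Proof.
elim: s => [|[u v] s IH] sc; first by exists 0.
have [m sm] : exists m, {subset s <= derived m}.
  by apply: IH => p ps; apply: sc; rewrite inE ps orbT.
have [n uv] := derived_complete (sc (u, v) (mem_head _ _)).
exists (maxn m n) => p /predU1P[->|/sm].
  exact: derived_mono (leq_maxr _ _) _ uv.
exact: derived_mono (leq_maxl _ _) _.
Qed.

(* An edge ((p, u), q) goes from p to q; the states are words and only edges
   labelled by a single letter are ever used. *)
Notation edge := (word * word * word)%type.

Definition step (T : seq edge) (P : seq word) (x : X) : seq word :=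
  [seq e.2 | e <- T & (e.1.1 \in P) && (e.1.2 == [:: x])].

Definition reach T p (u : word) := foldl (step T) [:: p] u.

(** Sources of edges are left out, since a path from [p] can only end in [p] or in the target of an
    edge. *)
Definition states p (T : seq edge) := p :: [seq e.2 | e <- T].


Lemma subset_foldl_step T P Q u :
  {subset P <= Q} -> {subset foldl (step T) P u <= foldl (step T) Q u}.
Proof.
elim: u P Q => //= x u IH P Q sPQ; apply: IH => q /mapP[e].
rewrite mem_filter -andbA => /and3P[/sPQ eQ ex eT] ->.
by apply: map_f; rewrite mem_filter eQ ex.
Qed.

(** A step acts on each state separately; hence paths can be cut at an intermediate state, as in
    [mem_reach_cat]. *)
Lemma mem_foldl_step T P u q :
  q \in foldl (step T) P u <-> exists2 p, p \in P & q \in reach T p u.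
Proof.
split=> [|[p pP]]; last by apply: subset_foldl_step => r; rewrite inE => /eqP->.
elim: u q P => [|x u IH] q P /= => [qP|/IH[p /mapP[e]]].
  by exists q; rewrite ?mem_head.
rewrite mem_filter -andbA => /and3P[eP ex eT] -> qe.
exists e.1.1 => //; apply: subset_foldl_step qe => r; rewrite inE => /eqP->.
by apply: map_f; rewrite mem_filter mem_head ex.
Qed.

Lemma mem_reach_cat T p u v q :
  q \in reach T p (u ++ v) <-> exists2 r, r \in reach T p u & q \in reach T r v.
Proof. by rewrite /reach foldl_cat; apply: mem_foldl_step. Qed.

Lemma reach_states T p u : {subset reach T p u <= states p T}.
Proof.
move=> q; case/lastP: u => [|u x].
  by rewrite inE => /eqP->; apply: mem_head.
rewrite /reach -cats1 foldl_cat /= => /mapP[e].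
rewrite mem_filter => /andP[_ eT] ->.
by rewrite inE map_f ?orbT.
Qed.

(** A certificate consists of a derivation level [n], an initial state [i], a terminal state [t] and
    the edges [T]. The derivations for [i], [t] and the edges ensure that only words congruent to
    [w] lead from [i] to [t]; the path labelled [w] and the check of the relations ensure that all
    of them do. *)
Definition certifies (w : word) (c : nat * (word * word) * seq edge) :=
  let: n := c.1.1 in let: i := c.1.2.1 in let: t := c.1.2.2 in let: T := c.2 in
  [&& (i, [::]) \in derived n, (t, w) \in derived n, t \in reach T i w,
      all (fun e => (e.1.1 ++ e.1.2, e.2) \in derived n) T
    & all (fun p => all (fun r =>
        all (fun q => q \in reach T p r.2) (reach T p r.1) &&
        all (fun q => q \in reach T p r.1) (reach T p r.2)) rels) (states i T)].

Variables (A : finType) (s : A -> word).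

(** Inverse image under the substitution [s]: a transition by [a] stands for a whole path labelled
    [s a]. *)
Definition cert_automaton (c : nat * (word * word) * seq edge) : automaton A :=
  let: i := c.1.2.1 in let: t := c.1.2.2 in let: T := c.2 in
  Automaton [:: pickle i]
    [seq (pickle pa.1, pa.2, pickle q) |
      pa <- [seq (p, a) | p <- states i T, a <- enum A],
      q <- reach T pa.1 (s pa.2)]
    [:: pickle t].

Section Correctness.
Variables (w : word) (n : nat) (i t : word) (T : seq edge).
Let c := (n, (i, t), T).
Hypothesis cw : certifies w c.

(** The derivations attached to the edges are composed along the path. *)
Lemma reach_sound p u q : q \in reach T p u -> cong (p ++ u) q.
Proof.
have /and5P[_ _ _ /allP edgesP _] := cw.
elim: u p => [|x u IH] p.
  by rewrite inE cats0 => /eqP->; apply: pres_cong_refl.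
move=> /(mem_reach_cat T p [:: x] u)[r /mapP[e]].
rewrite mem_filter inE -andbA => /and3P[/eqP ep /eqP ex eT] -> /IH ruq.
rewrite -cat1s catA; apply: pres_cong_trans ruq.
apply: pres_cong_mul (pres_cong_refl _ _).
by have := derived_sound (edgesP e eT); rewrite ep ex.
Qed.

(** By induction on the congruence, the check of the relations being the base case. For products,
    the state between the two factors is again in [states i T], so the induction hypothesis applies
    there. *)
Lemma reach_cong u v : cong u v ->
  forall p q, p \in states i T -> q \in reach T p u <-> q \in reach T p v.
Proof.
have /and5P[_ _ _ _ /allP relsP] := cw.
have statesW p q u' :
    p \in states i T -> q \in reach T p u' -> q \in states i T.
  move=> pS /reach_states; rewrite !inE => /predU1P[-> //|qT].
  by rewrite qT orbT.
elim=> {u v} [u v uv|u|u v _ IH|u v x _ IH1 _ IH2|u u' v v' _ IH1 _ IH2] p q pS.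
- have /allP/(_ _ uv)/andP[/allP uvP /allP vuP] := relsP p pS.
  by split=> [/uvP|/vuP].
- by [].
- by rewrite IH.
- by rewrite IH1 // IH2.
by split=> /mem_reach_cat[r pr rq]; apply/mem_reach_cat; exists r;
  first [exact/(IH1 _ _ pS) | apply/IH2 => //; apply: statesW pr].
Qed.

Lemma mem_cert_transitions p a k : p \in states i T ->
  (pickle p, a, k) \in transitions (cert_automaton c) <->
  exists2 q, k = pickle q & q \in reach T p (s a).
Proof.
move=> pS; split=> [/allpairsPdep[[p' a'] [q [_ /= pq []]]]|[q -> pq]].
  by move=> /(pcan_inj pickleK) -> -> ->; exists q.
apply/allpairsPdep; exists (p, a), q; split=> //.
by apply/allpairsP; exists (p, a); rewrite mem_enum.
Qed.

Lemma run_cert_automaton p u k : p \in states i T ->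
  run (cert_automaton c) (pickle p) u k <->
  exists2 q, k = pickle q & q \in reach T p (flatten (map s u)).
Proof.
elim: u p => [|a u IH] p pS.
  split=> [<-|[q -> ]]; first by exists p; rewrite ?mem_head.
  by rewrite inE => /eqP->.
have step_states q : q \in reach T p (s a) -> q \in states i T.
  move=> /reach_states; rewrite inE => /predU1P[-> //|qT].
  by rewrite inE qT orbT.
split=> [[_ /(mem_cert_transitions _ _ pS)[r -> pr]]
        |[q Dk /mem_reach_cat[r pr rq]]].
  move=> /(IH _ (step_states r pr))[q Dk rq].
  by exists q => //; apply/mem_reach_cat; exists r.
exists (pickle r); first by apply/mem_cert_transitions => //; exists r.
by apply/IH; [apply: step_states | exists q].
Qed.

(** A path from [i] to [t] gives a congruence by [reach_sound], as [i] represents 1 and [t]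
    represents [w]. Conversely, [reach_cong] transfers the certified path labelled [w] to any
    congruent word. *)
Lemma recognized_cert_automaton u :
  recognized (cert_automaton c) u <-> cong (flatten (map s u)) w.
Proof.
have /and5P[/derived_sound /= i1 /derived_sound /= tw iw _ _] := cw.
have iS : i \in states i T by apply: mem_head.
split=> [[_ [_ [/predU1P[->|//] /predU1P[->|//]]]]|uw].
  move=> /(run_cert_automaton u _ iS)[q /(pcan_inj pickleK) <- /reach_sound it].
  apply: pres_cong_trans tw; apply: pres_cong_trans it.
  by apply: pres_cong_mul (pres_cong_sym i1) (pres_cong_refl _ _).
exists (pickle i), (pickle t); split; rewrite ?inE //.
by apply/run_cert_automaton => //; exists t => //; apply/(reach_cong uw).
Qed.

End Correctness.

(** * Computability of the check and of the automaton *)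

Lemma computable_derived (G : countType) (n : G -> nat) :
  computable n -> computable (fun x => derived (n x)).
Proof.
move=> cn; apply: computable_iter cn _ (computable_const _ _).
apply: computable_cat; first by comp_proj.
apply: computable_cat.
  by apply: computable_map; [apply: computable_pair | ]; comp_proj.
apply: computable_cat; apply: computable_allpairs; try comp_proj.
  apply: computable_pair; try comp_proj; apply: computable_if; try comp_proj.
  by apply: computable_eq; comp_proj.
by apply: computable_pair; apply: computable_cat; comp_proj.
Qed.

Lemma computable_reach (G : countType) (T : G -> seq edge) (p u : G -> word) :
  computable T -> computable p -> computable u ->
  computable (fun x => reach (T x) (p x) (u x)).
Proof.
move=> cT cp cu; apply: computable_foldl => //; last first.
  by apply: computable_cons => //; comp_proj.
apply: computable_map; first by comp_proj.
apply: computable_filter; last by apply: (computable_comp cT); comp_proj.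
apply: computable_and; first by apply: computable_mem; comp_proj.
by apply: computable_eq; [ | apply: computable_cons]; comp_proj.
Qed.

Lemma computable_states (G : countType) (p : G -> word) (T : G -> seq edge) :
  computable p -> computable T -> computable (fun x => states (p x) (T x)).
Proof.
move=> cp cT; apply: computable_cons => //.
by apply: computable_map => //; comp_proj.
Qed.

Lemma computable_certifies (G : countType) (w : G -> word)
    (c : G -> nat * (word * word) * seq edge) :
  computable w -> computable c -> computable (fun x => certifies (w x) (c x)).
Proof.
move=> cw cc.
have cn : computable (fun x => derived (c x).1.1).
  by apply: computable_derived; comp_proj.
have ci : computable (fun x => (c x).1.2.1) by comp_proj.
have ct : computable (fun x => (c x).1.2.2) by comp_proj.
have cT : computable (fun x => (c x).2) by comp_proj.
apply: computable_and.
  by apply: computable_mem => //; apply: computable_pair; comp_proj.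
apply: computable_and.
  by apply: computable_mem => //; apply: computable_pair.
apply: computable_and.
  by apply: computable_mem => //; apply: computable_reach.
apply: computable_and.
  apply: computable_all => //; apply: computable_mem.
    by apply: computable_pair; [apply: computable_cat | ]; comp_proj.
  by apply: (computable_comp cn); comp_proj.
apply: computable_all; last exact: computable_states.
apply: computable_all; last exact: computable_const.
have cT' : computable (fun p : G * word * (word * word) => (c p.1.1).2).
  by apply: (computable_comp cT); comp_proj.
have cR1 : computable (fun p : G * word * (word * word) =>
    reach (c p.1.1).2 p.1.2 p.2.1).
  by apply: computable_reach => //; comp_proj.
have cR2 : computable (fun p : G * word * (word * word) =>
    reach (c p.1.1).2 p.1.2 p.2.2).
  by apply: computable_reach => //; comp_proj.
apply: computable_and; apply: computable_all => //.
  by apply: computable_mem; [ | apply: (computable_comp cR2)]; comp_proj.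
by apply: computable_mem; [ | apply: (computable_comp cR1)]; comp_proj.
Qed.

Lemma computable_cert_automaton (G : countType)
    (c : G -> nat * (word * word) * seq edge) :
  computable c -> computable (fun x => cert_automaton (c x)).
Proof.
move=> cc.
have ci : computable (fun x => (c x).1.2.1) by comp_proj.
have ct : computable (fun x => (c x).1.2.2) by comp_proj.
have cT : computable (fun x => (c x).2) by comp_proj.
(* An automaton is pickled through its data, so both functions have the same codes as values. *)
suff : computable (fun x => automaton_data (cert_automaton (c x))) by [].
apply: computable_pair; last by apply: computable_cons; comp_proj.
apply: computable_pair; first by apply: computable_cons; comp_proj.
apply: computable_allpairs.
- by apply: computable_pair; [apply: computable_pair | ]; comp_proj.
- apply: computable_allpairs; last by comp_proj.
    by apply: computable_pair; comp_proj.
  exact: computable_states.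
apply: computable_reach; try comp_proj.
  by apply: (computable_comp cT); comp_proj.
(* The substitution [s] is arbitrary, but it is a finite table. *)
by apply: computable_finType; comp_proj.
Qed.

End Certificates.

(** * Existence of certificates *)

Section Existence.
Variables (M : monoidType) (X : finType) (rels : seq (seq X * seq X)).
Variable f : monoid_hom (seq X) M.
Hypotheses (f_gen : generating f)
  (f_pres : forall u v, f u = f v <-> pres_cong rels u v).

(* The states are representatives of the factors of [f w]; a relation cannot
   leave this set, as prefixes of factors are factors. *)
Lemma certificate_exists (w : seq X) :
  finite_J_above M -> exists c, certifies rels w c.
Proof.
move=> /(_ (f w)) /finite_seqP[F FE].
have inF m : m \in F <-> factor m (f w).
  by rewrite -[factor _ _]/([set u | factor u (f w)] m) FE.
have inF_mul m m' : (m * m')%g \in F -> m \in F.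
  move=> /inF[x [y wE]]; apply/inF; exists x, (m' * y)%g.
  by rewrite wE !mulgA.
have oneF : 1%g \in F by apply/inF; exists (f w), 1%g; rewrite !mulg1.
have wF : f w \in F by apply/inF; exists 1%g, 1%g; rewrite mulg1 mul1g.
have [rep repK] := boolp.choice (f_gen : forall m, exists u, f u = m).
(* The edges are those of the right Cayley graph that start at a factor; [TF] keeps those that also
   end at one. *)
pose T : seq (seq X * seq X * seq X) :=
  [seq (rep m, [:: x], rep (m * f [:: x])%g) | m <- F, x <- enum X].
pose TF := [seq e <- T | f e.2 \in F].
have TFP e : e \in TF -> exists m x,
    [/\ m \in F, (m * f [:: x])%g \in F
      & e = (rep m, [:: x], rep (m * f [:: x])%g)].
  rewrite mem_filter => /andP[eF /allpairsP[[m x] /= [mF _ De]]].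
  by exists m, x; rewrite De repK in eF *.
(* The graph is deterministic: the path from [rep m] labelled [u] ends in [rep (m * f u)], and
   exists exactly when that product is a factor, since the intermediate products are then factors by
   [inF_mul]. *)
have reachP m u q : m \in F ->
    q \in reach TF (rep m) u <-> (m * f u)%g \in F /\ q = rep (m * f u)%g.
  elim: u m => [|x u IH] m mF.
    rewrite gmulf1 mulg1 inE; split=> [/eqP->|[_ ->]]; by [].
  have fxu : f (x :: u) = (f [:: x] * f u)%g by rewrite -gmulfM.
  rewrite (mem_reach_cat TF (rep m) [:: x] u) fxu mulgA; split.
    case=> _ /mapP[e + ->]; rewrite mem_filter inE -andbA => /and3P[em ex].
    move=> /TFP[m' [x' [m'F mxF De]]]; rewrite De /= in em ex *.
    have /(can_inj repK) <- := eqP em; case/eqP: ex => <-.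
    by move/(IH _ mxF).
  case=> mxuF Dq; have mxF := inF_mul _ _ mxuF.
  exists (rep (m * f [:: x])%g); last exact/(IH _ mxF).
  apply/mapP; exists (rep m, [:: x], rep (m * f [:: x])%g) => //.
  rewrite mem_filter /= inE !eqxx mem_filter /= repK mxF /=.
  by apply/allpairsP; exists (m, x); rewrite mem_enum.
(* All required pairs have equal images in [M], hence are derivable from the presentation. *)
have [n nP] : exists n, {subset (rep 1%g, [::]) :: (rep (f w), w) ::
    [seq (e.1.1 ++ e.1.2, e.2) | e <- TF] <= derived rels n}.
  apply: derived_all => p /predU1P[->|/predU1P[->|/mapP[e eT ->]]].
  - by apply/f_pres; rewrite repK gmulf1.
  - by apply/f_pres; rewrite repK.
  - have [m [x [_ _ ->]]] := TFP _ eT.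
    by apply/f_pres; rewrite /= gmulfM !repK.
exists (n, (rep 1%g, rep (f w)), TF); apply/and5P; split.
- by apply: nP; rewrite !inE eqxx.
- by apply: nP; rewrite !inE eqxx orbT.
- by apply/reachP => //; rewrite mul1g.
- by apply/allP => e eT; apply: nP; rewrite !inE map_f ?orbT.
apply/allP => p pS; apply/allP => -[u v] uv.
have [m mF ->] : exists2 m, m \in F & p = rep m.
  move: pS; rewrite inE => /predU1P[->|/mapP[e /TFP[m [x [_ mxF ->]]] ->]].
    by exists 1%g.
  by exists (m * f [:: x])%g.
(* By [reachP] the states reached depend only on the image of the label in [M]. *)
have fuv : f u = f v by apply/f_pres; apply: pres_cong_rel.
by apply/andP; split; apply/allP => q /reachP -/(_ mF) qP; apply/reachP;
  rewrite ?fuv // -fuv.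
Qed.

End Existence.

(** * Reduction of membership to the oracle *)

Lemma hom_flatten (M : monoidType) (A X : finType) (phi : monoid_hom (seq A) M)
    (f : monoid_hom (seq X) M) (s : A -> seq X) :
  (forall a, f (s a) = phi [:: a]) ->
  forall u, f (flatten (map s u)) = phi u.
Proof.
move=> sP; elim=> [|a u IH]; first by rewrite !gmulf1.
rewrite -[flatten _]/(s a * flatten (map s u))%g gmulfM sP IH.
by rewrite -[a :: u]/([:: a] * u)%g gmulfM.
Qed.

Theorem theorem3p6 (M : monoidType) (A : finType)
    (phi : monoid_hom (seq A) M) (L : set (seq A)) :
  finitely_presented M ->
  finite_J_above M ->
  decidable_problem (fun R : automaton A => L `&` recognized R = set0) ->
  membership_decidable (phi @` L).
Proof.
move=> [X [rels [f [f_gen f_pres]]]] J_above /decidable_computable oracle.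
move=> Y g g_gen.
(* The choices of [s] and [r] need not be effective: both have finite domains. They translate the
   letters of [A] and of the given generating alphabet [Y] into words over the presentation. *)
have [s sP] := boolp.choice (fun a : A => f_gen (phi [:: a])).
have [r rP] := boolp.choice (fun y : Y => f_gen (g [:: y])).
have [e ce eP] : enumerable
    (nat * (seq X * seq X) * seq (seq X * seq X * seq X))%type.
  have eW := enumerable_word X.
  by do ?[exact: enumerable_nat | exact: eW
    | apply: enumerable_prod | apply: enumerable_seq].
(* Search is only possible for functions which are total on all codes, so codes
   which are not letters are read as the empty word. *)
pose word l := flatten [seq oapp r [::] (pickle_inv n) | n <- CodeSeq.decode l].
have word_pickle w : word (pickle w) = flatten (map r w).
  rewrite /word pickle_word CodeSeq.codeK -map_comp; congr flatten.
  by apply: eq_map => y /=; rewrite pickleK_inv.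
have [h ch hP] : exists2 h : nat -> nat, computable h &
    forall l, certifies rels (word l) (e (h l)).
  apply: (computable_search (R := fun l n => certifies rels (word l) (e n))).
    apply: computable_certifies; last by apply: (computable_comp ce); comp_proj.
    apply: computable_word.
    by apply: (computable_comp computable_decode); comp_proj.
  move=> l; have [c lc] := certificate_exists f_gen f_pres (word l) J_above.
  by have [n En] := eP c; exists n; rewrite En.
pose B (w : seq Y) := cert_automaton s (e (h (pickle w))).
have BP w u : recognized (B w) u <-> phi u = g w.
  (* Both [phi] and [g] factor through [f], so the equation in [M] becomes a congruence of words
     over [X]. *)
  rewrite -(hom_flatten sP) -(hom_flatten rP) f_pres -word_pickle.
  have := hP (pickle w); rewrite /B; case: (e _) => [[n [i t]] T] cw.
  exact: recognized_cert_automaton.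
have cB : computable B.
  apply: computable_cert_automaton; apply: (computable_comp ce).
  by apply: (computable_comp ch); apply: computable_pickle; apply: computable_id.
apply/decidable_computable.
(* The oracle tests emptiness, so its answer is negated: [g w] lies in the image of [L] exactly when
   [L] meets the language of [B w]. *)
apply: eq_computable (computable_not (computable_comp oracle cB)) => w.
rewrite -asbool_neg; apply: asbool_equiv_eq; split=> [LB0|[u Lu uw] LB0].
  have [u [Lu /BP uw]] : L `&` recognized (B w) !=set0 by apply/set0P/eqP.
  by exists u.
by rewrite -[False]/(set0 u) -LB0; split=> //; apply/BP.
Qed.
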